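(* Let $(Y,X)$ and $(Y',X')$ be bivariate Bernoulli distributed random vectors, i.e. with values in $\{0,1\}^2$, with parameters $p_{ji}=P(Y=j,X=i)$ for $j,i\in\{0,1\}$, $q=P(Y=1)=p_{10}+p_{11}\in(0,1)$, $p=P(X=1)=p_{01}+p_{11}\in(0,1)$, $\alpha=p_{00}/(1-p)$, $\beta=p_{01}/p$, and $p'_{ji},q',p',\alpha',\beta'$ defined analogously for $(Y',X')$ (with $p',q'\in(0,1)$). Then the following two statements are equivalent: (i) $(Y,X)\preccurlyeq_{ccx}(Y',X')$; (ii) $q=q'$ as well as $\alpha'\wedge\beta'\le\alpha\wedge\beta$ and $\alpha\vee\beta\le\alpha'\vee\beta'$. Further: (iii) $X$ and $Y$ are independent if and only if $\alpha=\beta$; (iv) $Y$ perfectly depends on $X$ if and only if $\alpha\wedge\beta=0$ and $\alpha\vee\beta=1$; (v) $X$ and $Y$ are comonotone if and only if $\alpha=\frac{1-q}{1-p}\wedge1$; (vi) $X$ and $Y$ are countermonotone if and only if $\alpha=0\vee\left(1-\frac{q}{1-p}\right)$.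
   Context: $\wedge$ and $\vee$ denote minimum and maximum of two real numbers. $q_Y(v)=\inf\{y\mid F_Y(y)\ge v\}$, $v\in(0,1)$, where $F_Y$ is the distribution function of $Y$. For bounded random variables, $S\le_{cx}T$ means $\mathbb{E}\varphi(S)\le\mathbb{E}\varphi(T)$ for all convex $\varphi\colon\mathbb{R}\to\mathbb{R}$. Conditional convex order: $(Y,X)\preccurlyeq_{ccx}(Y',X')$ means $P(Y\ge q_Y(v)\mid X)\le_{cx}P(Y'\ge q_{Y'}(v)\mid X')$ for all $v\in(0,1)$. $Y$ perfectly depends on $X$ if $Y=f(X)$ almost surely for some measurable $f$. $X$ and $Y$ are comonotone (resp. countermonotone) if $(Y,X)\stackrel{d}{=}(q_Y(U),q_X(U))$ (resp. $(Y,X)\stackrel{d}{=}(q_Y(U),q_X(1-U))$) for $U\sim U(0,1)$. *)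

(* Defs.v *)
From HB Require Import structures.
From mathcomp Require Export all_boot all_order all_algebra.
From mathcomp Require Export all_classical all_reals all_analysis.
(* not re-exported by [all_analysis]; declares the measurable structure of [\bar R] *)
From mathcomp Require Export measurable_realfun.
Set Implicit Arguments.
Unset Strict Implicit.
Unset Printing Implicit Defensive.
Import Order.TTheory GRing.Theory Num.Theory.
Import numFieldNormedType.Exports.
Local Open Scope classical_set_scope.
Local Open Scope ring_scope.

(* Only the values at [v] in ]0, 1[ matter below: elsewhere the set can be empty
   or unbounded below, and [inf] is then a default value. *)
Definition quantile d (T : measurableType d) (R : realType)
    (P : probability T R) (Y : {RV P >-> R}) (v : R) : R :=
  inf [set y : R | (v%:E <= cdf Y y)%E].

(* [W] is a version of P(A | X): it is integrable, measurable with respect to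
   the sigma-algebra generated by [X], and E[W 1_B] = P(A `&` B) for all [B] in
   that sigma-algebra. *)
Definition is_cond_prob d (T : measurableType d) (R : realType)
    (P : probability T R) (X : {RV P >-> R}) (A : set T) (W : T -> R) : Prop :=
  [/\ P.-integrable [set: T] (EFin \o W),
      measurable_fun [set: g_sigma_algebra_preimageType X] W
    & forall B : set T, g_sigma_algebra_preimage X B ->
        (\int[P]_(w in B) (W w)%:E = P (A `&` B))%E].

(* Versions exist (lemma [cond_probP]) and agree almost surely, so the choice of
   one is irrelevant in expectations. *)
Definition cond_prob d (T : measurableType d) (R : realType)
    (P : probability T R) (X : {RV P >-> R}) (A : set T) : T -> R :=
  xget (fun=> 0) [set W | is_cond_prob X A W].

Lemma cond_probP d (T : measurableType d) (R : realType)
    (P : probability T R) (X : {RV P >-> R}) (A : set T) :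
  measurable A -> is_cond_prob X A (cond_prob X A).
Proof.
move=> mA; apply: xgetPex.
have mX : measurable_fun [set: T] X by [].
have Aoo : (P A < +oo)%E by exact: le_lt_trans (probability_le1 P mA) (ltry 1).
pose nu : {measure set R -> \bar R} :=
  measure_function_pushforward__canonical__measure_function_Measure (mfrestr mA Aoo) mX.
have mXB (B : set R) : measurable B -> measurable (X @^-1` B).
  by move=> mB; rewrite -[X in measurable X]setTI; exact: (mX measurableT B mB).
have nuE B : nu B = P (X @^-1` B `&` A) by [].
have nufin : fin_num_fun nu.
  by move=> B mB; rewrite nuE fin_num_measure//; apply: measurableI => //; exact: mXB.
pose nuM := Measure_isFinite.Build _ _ _ nu nufin.
pose nu' : {finite_measure set R -> \bar R} := HB.pack (nu : set R -> \bar R) (Measure.class nu) nuM.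
have nu_mu : nu' `<< distribution P X.
  apply/null_content_dominatesP => B mB PB0.
  apply/eqP; rewrite eq_le measure_ge0 andbT -PB0.
  apply: le_measure; rewrite ?inE//; [apply: measurableI => //|]; exact: mXB.
have [f [f0 ffin fint fE]] := radon_nikodym_sigma_finite nu_mu.
have mf := measurable_int _ fint.
have fXE : EFin \o (fun w => fine (f (X w))) = f \o X.
  by apply/funext => w /=; rewrite fineK.
exists (fun w => fine (f (X w))); split.
- rewrite fXE; apply/integrableP; split; first exact: (measurableT_comp mf mX).
  move/integrableP: fint => [_].
  rewrite ge0_integral_distribution//. exact: (measurableT_comp (@abse_measurable R setT) mf).
- move=> _ B mB; rewrite setTI.
  exists ((fine \o f) @^-1` B); last by rewrite setTI.
  by rewrite -[X in measurable X]setTI; apply: (measurableT_comp (fine_measurable measurableT) mf).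
- move=> _ [B mB <-]; rewrite setTI.
  rewrite setIC -[RHS]/(nu' B) (fE _ mB).
  rewrite ge0_integral_pushforward//; last exact: measurable_funTS.
  by apply: eq_integral => w _; rewrite fineK.
Qed.

(* Meant for [S] and [S'] that are almost surely bounded, so that both
   expectations are finite. *)
Definition cx_le d d' (T : measurableType d) (T' : measurableType d')
    (R : realType) (P : probability T R) (P' : probability T' R)
    (S : T -> R) (S' : T' -> R) : Prop :=
  forall phi : R -> R, convex_function [set: R] phi ->
    ('E_P[phi \o S] <= 'E_P'[phi \o S'])%E.

Definition ccx_le d d' (T : measurableType d) (T' : measurableType d')
    (R : realType) (P : probability T R) (P' : probability T' R)
    (Y X : {RV P >-> R}) (Y' X' : {RV P' >-> R}) : Prop :=
  forall v : R, 0 < v < 1 ->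
    cx_le P P' (cond_prob X [set w | quantile Y v <= Y w])
               (cond_prob X' [set w | quantile Y' v <= Y' w]).

Definition independent_rv d (T : measurableType d) (R : realType)
    (P : probability T R) (X Y : {RV P >-> R}) : Prop :=
  forall A B : set R, measurable A -> measurable B ->
    (P (X @^-1` A `&` Y @^-1` B) = P (X @^-1` A) * P (Y @^-1` B))%E.

Definition perfectly_depends d (T : measurableType d) (R : realType)
    (P : probability T R) (Y X : {RV P >-> R}) : Prop :=
  exists2 f : R -> R, measurable_fun [set: R] f &
    {ae P, forall w, Y w = f (X w)}.

(* U ~ U(0,1) is realized as the identity of [R] under [uniform_prob ltr01], so
   that the law of g(U) is the pushforward of [uniform_prob ltr01] by g. *)
Definition comonotone d (T : measurableType d) (R : realType)
    (P : probability T R) (X Y : {RV P >-> R}) : Prop :=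
  forall A : set (R * R), measurable A ->
    pushforward P (fun w => (Y w, X w)) A =
    pushforward (uniform_prob (@ltr01 R))
      (fun u : R => (quantile Y u, quantile X u)) A.

Definition countermonotone d (T : measurableType d) (R : realType)
    (P : probability T R) (X Y : {RV P >-> R}) : Prop :=
  forall A : set (R * R), measurable A ->
    pushforward P (fun w => (Y w, X w)) A =
    pushforward (uniform_prob (@ltr01 R))
      (fun u : R => (quantile Y u, quantile X (1 - u))) A.

Definition bivariate_bernoulli d (T : measurableType d) (R : realType)
    (P : probability T R) (Y X : {RV P >-> R}) : Prop :=
  {ae P, forall w, (Y w = 0 \/ Y w = 1) /\ (X w = 0 \/ X w = 1)}.

Definition joint_pmf d (T : measurableType d) (R : realType)
    (P : probability T R) (Y X : {RV P >-> R}) (j i : R) : R :=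
  fine (P [set w | Y w = j /\ X w = i]).

(* Main.v *)
(* Conditionally on a binary [X], the probability of [{Y >= q_Y(v)}] is 1 for
   [v <= 1 - q]; for [v > 1 - q] it takes the two values [1 - alpha] and
   [1 - beta] with weights [1 - p] and [p], hence has mean [q].  Two-point laws
   with a common mean are in convex order exactly when the interval spanned by
   the values of the first lies in that of the second: bound a convex function
   by its chord, and conversely test on positive parts of affine functions.
   Independence, comonotonicity and countermonotonicity are decided by [p_11]
   (equivalently by [alpha]), since the marginals and [p_11] determine the joint
   law; for the couplings of the quantile functions [p_11] is the length of the
   intersection of two intervals: [min q p], respectively [max 0 (p + q - 1)]. *)
Require Import Defs.
From mathcomp Require Import ring lra.
Set Implicit Arguments.
Unset Strict Implicit.
Unset Printing Implicit Defensive.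
Import Order.TTheory GRing.Theory Num.Theory.
Import numFieldNormedType.Exports.
Local Open Scope classical_set_scope.
Local Open Scope ring_scope.

(** * Joint laws of binary random variables *)

Section Law.
Context d (T : measurableType d) (R : realType) (P : probability T R).
Implicit Types (X Y : {RV P >-> R}) (A E : set T).

Lemma prob_fineE A : measurable A -> P A = (fine (P A))%:E.
Proof. by move=> mA; rewrite fineK// fin_num_measure. Qed.

(** Adjoining the null exceptional set [N] to both sets changes neither probability and makes the
    sets equal. *)
Lemma ae_eq_prob A B : measurable A -> measurable B ->
  {ae P, forall w, A w <-> B w} -> P A = P B.
Proof.
move=> mA mB [N [mN PN0 AB]]; rewrite -(measureU0 mA mN PN0).
rewrite -(measureU0 mB mN PN0); congr (P _).
apply/seteqP; split=> w [Hw|]; try by right.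
- by have [Nw|nNw] := pselect (N w); [right|left; move/subsetCl : AB => /(_ w nNw) /= <-].
- by have [Nw|nNw] := pselect (N w); [right|left; move/subsetCl : AB => /(_ w nNw) /= ->].
Qed.

Lemma bernoulli_split X A : {ae P, forall w, X w = 0 \/ X w = 1} -> measurable A ->
  fine (P A) = fine (P (A `&` X @^-1` [set 0])) + fine (P (A `&` X @^-1` [set 1])).
Proof.
move=> X01 mA.
have mX r : measurable (X @^-1` [set r]) by exact: measurable_funPTI.
rewrite -fineD ?fin_num_measure//; try exact: measurableI.
rewrite -measureU; try exact: measurableI; last first.
  by apply/seteqP; split=> // w [[_ /= ->] [_ /= /eqP]]; rewrite eq_sym oner_eq0.
congr fine; apply: ae_eq_prob => //.
  by apply: measurableU; exact: measurableI.
apply: filterS X01 => w X01w; split=> [Aw|[[]|[]]//].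
by case: X01w => Xw; [left|right].
Qed.

Lemma measurable_pair_RV X Y (S : set (R * R)) : measurable S ->
  measurable [set w | S (Y w, X w)].
Proof.
move=> mS; rewrite -[X in measurable X]setTI.
by apply: (measurable_fun_pair (measurable_funPT Y) (measurable_funPT X)).
Qed.

(** Cutting the event along the values of [X], then of [Y], leaves four pieces, each a full atom or
    empty according to whether [S] contains the corresponding point. *)
Lemma bernoulli_joint_law Y X (S : set (R * R)) :
  bivariate_bernoulli Y X -> measurable S ->
  fine (P [set w | S (Y w, X w)]) =
    joint_pmf Y X 0 0 * \1_S (0, 0) + joint_pmf Y X 0 1 * \1_S (0, 1)
  + joint_pmf Y X 1 0 * \1_S (1, 0) + joint_pmf Y X 1 1 * \1_S (1, 1).
Proof.
move=> YX mS.
have X01 : {ae P, forall w, X w = 0 \/ X w = 1} by apply: filterS YX => w [].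
have Y01 : {ae P, forall w, Y w = 0 \/ Y w = 1} by apply: filterS YX => w [].
have mX r : measurable (X @^-1` [set r]) by exact: measurable_funPTI.
have mY r : measurable (Y @^-1` [set r]) by exact: measurable_funPTI.
have mS' := measurable_pair_RV X Y mS.
rewrite (bernoulli_split X01 mS') (bernoulli_split Y01 (measurableI _ _ mS' (mX 0))).
rewrite (bernoulli_split Y01 (measurableI _ _ mS' (mX 1))).
have E j i : fine (P ([set w | S (Y w, X w)] `&` X @^-1` [set i]
                      `&` Y @^-1` [set j])) = joint_pmf Y X j i * \1_S (j, i).
  rewrite /joint_pmf indicE; have [|] := boolP ((j, i) \in S).
    rewrite inE mulr1 => Sji; congr (fine (P _)).
    by apply/seteqP; split=> [w [[_ ? ?]]|w [/= Yw Xw]] //=; rewrite Yw Xw.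
  rewrite notin_setE mulr0 => Sji; rewrite [X in P X](_ : _ = set0) ?measure0//.
  by apply/seteqP; split=> // w [[/= + Xw] Yw]; rewrite Yw Xw.
rewrite !E; ring.
Qed.

End Law.

(** * Convex functions and two-point laws *)

Section Convex.
Variable R : realType.
Implicit Type phi : R -> R.

Lemma convex_functionP phi : convex_function [set: R] phi <->
  forall t x y, 0 <= t <= 1 ->
    phi (t * x + (1 - t) * y) <= t * phi x + (1 - t) * phi y.
Proof.
split=> [cphi t x y t01|cphi t x y _ _].
  have := cphi (Itv01 (andP t01).1 (andP t01).2) x y (mem_set I) (mem_set I).
  by rewrite !convRE.
by rewrite !convRE; apply: cphi; rewrite ge0 le1.
Qed.

(** Kept free of division, so that chord bounds can be combined after scaling an inequality by the
    length of the interval. *)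
Lemma convex_chord phi (x y z : R) : convex_function [set: R] phi ->
  x < y -> x <= z <= y ->
  phi z * (y - x) <= phi x * (y - z) + phi y * (z - x).
Proof.
move=> /convex_functionP cphi xy /andP[xz zy].
have yx0 : 0 < y - x by rewrite subr_gt0.
have t01 : 0 <= (y - z) / (y - x) <= 1.
  by rewrite divr_ge0 ?subr_ge0 ?(ltW xy)//= ler_pdivrMr// mul1r lerD2l lerN2.
have zE : z = (y - z) / (y - x) * x + (1 - (y - z) / (y - x)) * y.
  by field; rewrite gt_eqF.
rewrite [in X in X <= _]zE -ler_pdivlMr//.
apply: (le_trans (cphi _ x y t01)).
by rewrite le_eqVlt; apply/orP; left; apply/eqP; field; rewrite gt_eqF.
Qed.

(** Strict sublevel sets of a convex function are intervals, and open rays generate the Borel sets.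
    This lets the expectation formulas for measurable functions be applied to every convex test
    function. *)
Lemma convex_measurable phi : convex_function [set: R] phi ->
  measurable_fun [set: R] phi.
Proof.
move=> cphi mD; apply: (measurability _ (RGenInftyO.measurableE R)) => //.
move=> /= _ [_ [r ->] <-]; rewrite setTI; apply: is_interval_measurable.
move=> x y; rewrite /= !in_itv/= => xr yr z /andP[xz zy].
rewrite in_itv/=.
have [xy|xy] := ltP x y; last first.
  by rewrite (_ : z = x)//; apply/eqP; rewrite eq_le xz (le_trans zy).
have H := convex_chord cphi xy (introT andP (conj xz zy)).
rewrite -(ltr_pM2r (_ : 0 < y - x)) ?subr_gt0//; apply: (le_lt_trans H).
have -> : r * (y - x) = r * (y - z) + r * (z - x) by ring.
(* Strictness comes from the term at [y], whose weight [z - x] vanishes when [z = x]; in that case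
   the term at [x] supplies it. *)
move: xz zy; rewrite le_eqVlt => /orP[/eqP<- _|xz zy].
  by rewrite subrr !mulr0 !addr0 ltr_pM2r// subr_gt0.
by apply: ler_ltD; [rewrite ler_wpM2r ?subr_ge0// ltW|rewrite ltr_pM2r// subr_gt0].
Qed.

(* When [a' != b'], the bound is the value at the common mean of the chord of
   [phi] over the interval between [a'] and [b']. *)
Lemma convex_two_point phi (r a b r' a' b' : R) : convex_function [set: R] phi ->
  0 <= r <= 1 ->
  (1 - r) * a + r * b = (1 - r') * a' + r' * b' ->
  Num.min a' b' <= Num.min a b -> Num.max a b <= Num.max a' b' ->
  (1 - r) * phi a + r * phi b <= (1 - r') * phi a' + r' * phi b'.
Proof.
move=> cphi r01 mean.
wlog ab' : r' a' b' mean / a' <= b'.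
  move=> H; have /orP[ab'|ba'] := le_total a' b'; first exact: H.
  have := H (1 - r') b' a' _ ba'; rewrite subKr (minC b') (maxC b') (addrC (r' * phi b')).
  by apply; rewrite mean addrC.
rewrite (min_l ab') (max_r ab') le_min ge_max => /andP[a'a a'b] /andP[ab bb].
move: ab'; rewrite le_eqVlt => /orP[/eqP ab'|ab'].
  subst b'.
  have <- : a = a' by apply/eqP; rewrite eq_le a'a ab.
  have -> : b = a by apply/eqP; rewrite eq_le (le_trans bb)// (le_trans ab).
  by rewrite -!mulrDl !subrK.
have Ha := convex_chord cphi ab' (introT andP (conj a'a ab)).
have Hb := convex_chord cphi ab' (introT andP (conj a'b bb)).
rewrite -(ler_pM2r (_ : 0 < b' - a')) ?subr_gt0//.
have -> : ((1 - r') * phi a' + r' * phi b') * (b' - a') =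
  (1 - r) * (phi a' * (b' - a) + phi b' * (a - a')) +
  r * (phi a' * (b' - b) + phi b' * (b - a')).
  transitivity (phi a' * (b' - ((1 - r) * a + r * b)) +
                phi b' * ((1 - r) * a + r * b - a')).
    by rewrite mean; ring.
  by ring.
rewrite mulrDl -!mulrA; apply: lerD; apply: ler_wpM2l => //; lra.
Qed.

Lemma convex_id : convex_function [set: R] (id : R -> R).
Proof. by apply/convex_functionP. Qed.

Lemma convex_opp : convex_function [set: R] (-%R : R -> R).
Proof. by apply/convex_functionP => t x y _; lra. Qed.

Lemma convex_max phi psi : convex_function [set: R] phi ->
  convex_function [set: R] psi ->
  convex_function [set: R] (fun x => Num.max (phi x) (psi x)).
Proof.
move=> /convex_functionP cphi /convex_functionP cpsi.
apply/convex_functionP => t x y t01.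
have [t0 t1] := andP t01.
rewrite ge_max; apply/andP; split.
- apply: le_trans (cphi _ x y t01) _.
  by apply: lerD; apply: ler_wpM2l; rewrite ?le_max ?lexx ?subr_ge0.
- apply: le_trans (cpsi _ x y t01) _.
  by apply: lerD; apply: ler_wpM2l; rewrite ?le_max ?lexx ?subr_ge0 ?orbT.
Qed.

Lemma convex_affine c k : convex_function [set: R] (fun x : R => c * x + k).
Proof.
by apply/convex_functionP => t x y _; rewrite le_eqVlt; apply/orP; left; apply/eqP; ring.
Qed.

(* Tested on the convex functions [x |-> max (x - max a' b') 0] and
   [x |-> max (min a' b' - x) 0], which vanish at [a'] and [b']. *)
Lemma convex_two_point_range (r a b r' a' b' : R) : 0 < r < 1 ->
  (forall phi, convex_function [set: R] phi ->
    (1 - r) * phi a + r * phi b <= (1 - r') * phi a' + r' * phi b') ->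
  Num.min a' b' <= Num.min a b /\ Num.max a b <= Num.max a' b'.
Proof.
case/andP=> r0; rewrite -subr_gt0 => r1 le_phi.
have test c k : c * a' + k <= 0 -> c * b' + k <= 0 ->
    c * a + k <= 0 /\ c * b + k <= 0.
  move=> ka' kb'.
  have := le_phi _ (convex_max (convex_affine c k) (convex_affine 0 0)).
  rewrite !mul0r !add0r (max_r ka') (max_r kb') !mulr0 addr0 => le0.
  have ma0 : 0 <= Num.max (c * a + k) 0 by rewrite le_max lexx orbT.
  have mb0 : 0 <= Num.max (c * b + k) 0 by rewrite le_max lexx orbT.
  have := addr_ge0 (mulr_ge0 (ltW r1) ma0) (mulr_ge0 (ltW r0) mb0).
  move=> /(conj le0)/andP; rewrite -eq_le.
  rewrite (paddr_eq0 (mulr_ge0 (ltW r1) ma0) (mulr_ge0 (ltW r0) mb0)).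
  rewrite !mulf_eq0 (gt_eqF r0) (gt_eqF r1)/= => /andP[/eqP ma /eqP mb].
  by split; [rewrite -ma|rewrite -mb]; rewrite le_max lexx.
split.
- have := test (-1) (Num.min a' b'); rewrite !mulN1r !(addrC (- _)) !subr_le0.
  by rewrite le_min !ge_min !lexx orbT => /(_ isT isT)[-> ->].
- have := test 1 (- Num.max a' b'); rewrite !mul1r !subr_le0.
  by rewrite ge_max !le_max !lexx orbT => /(_ isT isT)[-> ->].
Qed.

End Convex.

(** * Conditional probabilities given a binary variable *)

Section CondProb.
Context d (T : measurableType d) (R : realType) (P : probability T R).
Implicit Types (X Y : {RV P >-> R}) (A : set T).

(* The level sets of [X] are atoms of the sigma-algebra it generates, so every
   version of the conditional probability is constant on them. *)
Lemma cond_prob_atom X A w : measurable A -> pmf X (X w) != 0 ->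
  cond_prob X A w = fine (P (A `&` X @^-1` [set X w])) / pmf X (X w).
Proof.
move=> mA pX; have [_ + intW] := cond_probP X mA.
move: intW; set W := cond_prob X A => intW mW.
have mX : measurable (X @^-1` [set X w]) by exact: measurable_funPTI.
(* The level set of [W] through [w] is the preimage under [X] of a Borel set [B], so it contains
   every point at which [X] takes the value [X w]. *)
have [B mB BW] := mW measurableT _ (measurable_set1 (W w)).
have BWP u : B (X u) <-> W u = W w.
  have := congr1 (fun S : set T => S u) BW; rewrite /setI /= => E.
  by split=> Hu; [have : True /\ B (X u) by []; rewrite E => -[]|
                  have : True /\ W u = W w by []; rewrite -E => -[]].
have Wc w' : X w' = X w -> W w' = W w by move=> Xw'; apply/BWP; rewrite Xw'; apply/BWP.
have : g_sigma_algebra_preimage X (X @^-1` [set X w]).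
  by exists [set X w]; rewrite ?setTI.
move=> /intW.
rewrite (eq_integral (cst (W w)%:E)) => [|w']; last by rewrite inE/= => /Wc ->.
rewrite integral_cst// [X in (_ * X)%E](prob_fineE P mX) -EFinM => <-/=.
by rewrite mulfK.
Qed.

Lemma bernoulli_pmf0 X : {ae P, forall w, X w = 0 \/ X w = 1} ->
  pmf X 0 = 1 - pmf X 1.
Proof.
move=> X01; have := bernoulli_split X01 measurableT.
by rewrite probability_setT !setTI/= /pmf; lra.
Qed.

Lemma expectation_cond_prob X A (phi : R -> R) :
  {ae P, forall w, X w = 0 \/ X w = 1} -> measurable A ->
  measurable_fun [set: R] phi ->
  let p := pmf X 1 in 0 < p < 1 ->
  'E_P[phi \o cond_prob X A]%E =
    ((1 - p) * phi (fine (P (A `&` X @^-1` [set 0])) / (1 - p))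
     + p * phi (fine (P (A `&` X @^-1` [set 1])) / p))%:E.
Proof.
move=> X01 mA mphi p /andP[p0 p1].
have mX : measurable (X @^-1` [set 0]) by exact: measurable_funPTI.
have mW : measurable_fun [set: T] (phi \o cond_prob X A).
  apply: measurableT_comp => //; have [/measurable_int + _ _] := cond_probP X mA.
  by move/measurable_EFinP.
have p0E : pmf X 0 = 1 - p := bernoulli_pmf0 X01.
(* Splitting along [X = 0] and its complement covers the whole space exactly; on the complement
   [X = 1] holds only almost surely. *)
rewrite unlock -(setUv (X @^-1` [set 0])) integral_setU//; last 3 first.
- exact: measurableC.
- by rewrite setUv; apply/measurable_EFinP.
- exact/disj_setPCl.
set c0 := _ / (1 - p); set c1 := _ / p.
rewrite (eq_integral (cst (phi c0)%:E)) => [|w]; last first.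
  by rewrite inE/= => Xw; rewrite cond_prob_atom// Xw p0E// subr_eq0 gt_eqF.
rewrite [X in (_ + X)%E](ae_eq_integral (cst (phi c1)%:E)); last 4 first.
- exact: measurableC.
- by apply/measurable_EFinP; exact: measurable_funTS.
- exact: measurable_cst.
- apply: filterS X01 => w /= [//|Xw _].
  by rewrite cond_prob_atom// Xw// gt_eqF.
rewrite !integral_cst//; last exact: measurableC.
have PX : P (X @^-1` [set 0]) = (1 - p)%:E by rewrite (prob_fineE P mX) -p0E.
have PXC : P (~` (X @^-1` [set 0])) = p%:E.
  by rewrite probability_setC// PX -EFinB subKr.
rewrite [X in (_ * X + _)%E]PX [X in (_ + _ * X)%E]PXC -!EFinM -EFinD.
by congr (_%:E); ring.
Qed.

End CondProb.

(** * Distribution function and quantiles of a Bernoulli variable *)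

Section Quantile.
Context d (T : measurableType d) (R : realType) (P : probability T R).
Variable Y : {RV P >-> R}.
Hypothesis Y01 : {ae P, forall w, Y w = 0 \/ Y w = 1}.

Lemma bernoulli_cdf y :
  cdf Y y = (if y < 0 then 0 else if y < 1 then 1 - pmf Y 1 else 1)%:E.
Proof.
have mA : measurable (Y @^-1` `]-oo, y]) by exact: measurable_funPTI.
rewrite /cdf/= /distribution/pushforward (prob_fineE P mA); congr _%:E.
rewrite (bernoulli_split Y01 mA) -(bernoulli_pmf0 Y01).
have E r : fine (P (Y @^-1` `]-oo, y] `&` Y @^-1` [set r])) =
    if y < r then 0 else pmf Y r.
  case: ltP => yr.
    rewrite [X in P X](_ : _ = set0) ?measure0//.
    by apply/seteqP; split=> // w [/= + Yw]; rewrite in_itv/= Yw leNgt yr.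
  congr (fine (P _)); apply/seteqP; split=> w [] // Yw.
  by rewrite /= in_itv/= Yw.
rewrite !E; case: (ltP y 0) => y0; first by rewrite (lt_trans y0 ltr01) addr0.
by case: (ltP y 1) => y1; rewrite ?addr0// (bernoulli_pmf0 Y01) subrK.
Qed.

(** Valid for every real [v], because the default value of [inf] is 0: the set is unbounded below
    for [v <= 0] and empty for [v > 1]. Quantile functions can thus be replaced by indicators as
    functions on the whole line. *)
Lemma bernoulli_quantile v : 0 < pmf Y 1 < 1 ->
  quantile Y v = \1_`]1 - pmf Y 1, 1] v.
Proof.
set q := pmf Y 1 => /andP[q0 q1]; rewrite /quantile indicE.
have -> : [set y | (v%:E <= cdf Y y)%E] =
  [set y | v <= if y < 0 then 0 else if y < 1 then 1 - q else 1].
  by apply/seteqP; split=> y /=; rewrite bernoulli_cdf lee_fin.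
have memE : (v \in `]1 - q, 1]%classic) = (1 - q < v <= 1).
  by apply/idP/idP; rewrite inE/= in_itv.
rewrite memE; have [v0|v0] := leP v 0.
  rewrite ltNge (_ : v <= 1 - q) /=; last by lra.
  apply: inf_out => -[_ [x /= lbx]]; have := lbx (x - 1).
  have : v <= if x - 1 < 0 then 0 else if x - 1 < 1 then 1 - q else 1.
    by case: ifP => // _; case: ifP => _; lra.
  by move=> h /(_ h); lra.
have [vq|vq] := leP v (1 - q).
  rewrite (_ : [set y | _] = `[0, +oo[%classic) ?inf_itv ?bnd_simp//.
  apply/seteqP; split=> y /=; rewrite in_itv/= andbT.
    by case: (ltP y 0) => // _ ?; lra.
  by move=> y0; rewrite ltNge y0/=; case: ifP => _; lra.
have [v1|v1] := leP v 1.
  rewrite (_ : [set y | _] = `[1, +oo[%classic) ?inf_itv ?bnd_simp//.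
  apply/seteqP; split=> y /=; rewrite in_itv/= andbT.
    by case: (ltP y 0) => ?; [lra|case: (ltP y 1) => // ?; lra].
  by move=> y1; rewrite !ltNge y1 (le_trans ler01 y1)/=; lra.
rewrite (_ : [set y | _] = set0) ?inf0//; apply/seteqP; split=> y //=.
by case: ifP => _; [lra|case: ifP => _; lra].
Qed.

End Quantile.

(** * Joint masses in terms of conditional probabilities *)

Section Bivariate.
Context d (T : measurableType d) (R : realType) (P : probability T R).
Variables Y X : {RV P >-> R}.
Hypothesis YX : bivariate_bernoulli Y X.
Local Notation j := (joint_pmf Y X).
Local Notation q := (pmf Y 1).
Local Notation p := (pmf X 1).

Lemma bernoulli_fst : {ae P, forall w, Y w = 0 \/ Y w = 1}.
Proof. by apply: filterS YX => w []. Qed.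

Lemma bernoulli_snd : {ae P, forall w, X w = 0 \/ X w = 1}.
Proof. by apply: filterS YX => w []. Qed.

(** Choosing the whole line for one or both factors yields the marginals and the total mass. *)
Lemma bernoulli_rectangle (A B : set R) : measurable A -> measurable B ->
  fine (P (Y @^-1` A `&` X @^-1` B)) =
    \1_A 0 * (\1_B 0 * j 0 0 + \1_B 1 * j 0 1)
  + \1_A 1 * (\1_B 0 * j 1 0 + \1_B 1 * j 1 1).
Proof.
move=> mA mB; have := bernoulli_joint_law YX (measurableX mA mB).
have E a b : \1_(A `*` B) (a, b) = \1_A a * \1_B b :> R.
  rewrite !indicE -natrM mulnb; congr (nat_of_bool _)%:R.
  by apply/idP/andP; rewrite !inE.
by rewrite !E => ->; ring.
Qed.

Lemma joint_pmf_sum : j 0 0 + j 0 1 + j 1 0 + j 1 1 = 1.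
Proof.
have := bernoulli_rectangle measurableT measurableT.
by rewrite !preimage_setT setIT probability_setT !indicT/=; lra.
Qed.

Lemma pmf_fst : q = j 1 0 + j 1 1.
Proof.
have := bernoulli_rectangle (measurable_set1 1) measurableT.
rewrite preimage_setT setIT indicT !indicE !in_set1 eqxx eq_sym oner_eq0/= /pmf.
by move=> ->; lra.
Qed.

Lemma pmf_snd : p = j 0 1 + j 1 1.
Proof.
have := bernoulli_rectangle measurableT (measurable_set1 1).
rewrite preimage_setT setTI indicT !indicE !in_set1 eqxx eq_sym oner_eq0/= /pmf.
by move=> ->; lra.
Qed.

Lemma joint_pmf_ae0 y x : j y x = 0 -> {ae P, forall w, ~ (Y w = y /\ X w = x)}.
Proof.
move=> jyx.
have mS : measurable [set w | Y w = y /\ X w = x] :=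
  measurable_pair_RV X Y (measurableX (measurable_set1 y) (measurable_set1 x)).
exists [set w | Y w = y /\ X w = x]; split=> //.
  by rewrite (prob_fineE P mS); congr _%:E.
by move=> w /= /contrapT.
Qed.

Lemma joint_pmf_eq0 y x : {ae P, forall w, ~ (Y w = y /\ X w = x)} -> j y x = 0.
Proof.
move=> ae0.
have mS : measurable [set w | Y w = y /\ X w = x] :=
  measurable_pair_RV X Y (measurableX (measurable_set1 y) (measurable_set1 x)).
rewrite /joint_pmf (ae_eq_prob mS measurable0) ?measure0//.
by apply: filterS ae0 => w /= Nw; split.
Qed.

Hypothesis q01 : 0 < q < 1.
Hypothesis p01 : 0 < p < 1.
(** These are the conditional probabilities of [Y = 0] given [X = 0] and given [X = 1]. *)
Let alpha := j 0 0 / (1 - p).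
Let beta := j 0 1 / p.

Lemma alphaE : j 0 0 = alpha * (1 - p).
Proof. by rewrite /alpha divfK// subr_eq0 gt_eqF// (andP p01).2. Qed.

Lemma betaE : j 0 1 = beta * p.
Proof. by rewrite /beta divfK// gt_eqF// (andP p01).1. Qed.

Lemma joint_pmf10 : j 1 0 = (1 - alpha) * (1 - p).
Proof. by move: joint_pmf_sum pmf_snd; rewrite alphaE; lra. Qed.

Lemma joint_pmf11 : j 1 1 = (1 - beta) * p.
Proof. by move: joint_pmf_sum pmf_snd; rewrite betaE; lra. Qed.

(** The law of total probability. It provides the common mean of the two-point laws once
    [q = q']. *)
Lemma pmf_fstE : (1 - p) * (1 - alpha) + p * (1 - beta) = q.
Proof. by rewrite pmf_fst joint_pmf10 joint_pmf11; ring. Qed.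

(** For [v <= 1 - q] the quantile is 0 and the event is almost sure; above that threshold the
    quantile is 1 and the event is almost surely [Y = 1]. *)
Lemma expectation_cond_prob_bernoulli v (phi : R -> R) : 0 < v < 1 ->
  measurable_fun [set: R] phi ->
  'E_P[phi \o cond_prob X [set w | (quantile Y v <= Y w)%R]]%E =
    (if v <= 1 - q then phi 1
     else (1 - p) * phi (1 - alpha) + p * phi (1 - beta))%:E.
Proof.
move=> v01 mphi; set c := quantile Y v.
have -> : [set w | c <= Y w] = Y @^-1` `[c, +oo[.
  by apply/seteqP; split=> w /=; rewrite in_itv/= andbT.
have mA : measurable (Y @^-1` `[c, +oo[) by exact: measurable_funPTI.
rewrite (expectation_cond_prob bernoulli_snd mA mphi p01); congr _%:E.
rewrite !bernoulli_rectangle// !indicE !in_set1 !eqxx oner_eq0.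
rewrite (eq_sym 0) oner_eq0/= !mul1r !mul0r addr0 add0r.
have memE a : (a \in `[c, +oo[%classic) = (c <= a).
  by apply/idP/idP; rewrite inE/= in_itv/= andbT.
rewrite !memE /c (bernoulli_quantile bernoulli_fst _ q01) indicE.
have -> : (v \in `]1 - q, 1]%classic) = ~~ (v <= 1 - q).
  case/andP: v01 => _ /ltW v1; rewrite -ltNge.
  by apply/idP/idP; rewrite inE/= in_itv/= v1 andbT.
have p0 : p != 0 by rewrite gt_eqF//; case/andP: p01.
have p1 : 1 - p != 0 by rewrite subr_eq0 gt_eqF//; case/andP: p01.
case: ifP => _ /=; last first.
  rewrite lexx leNgt ltr01/= !mul0r !mul1r !add0r joint_pmf10 joint_pmf11.
  by rewrite addr0 !mulfK.
rewrite lexx ler01/= !mul1r !add0r !addr0.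
have -> : j 0 0 + j 1 0 = 1 - p by rewrite alphaE joint_pmf10; ring.
by rewrite -pmf_snd !divff//; ring.
Qed.

End Bivariate.

(** * The uniform law on intervals *)

Section Uniform.
Variable R : realType.
Local Notation U := (uniform_prob (@ltr01 R)).

Lemma uniform_prob_sub (A : set R) : measurable A -> A `<=` `[0, 1] ->
  U A = lebesgue_measure A.
Proof.
move=> mA A01; rewrite /uniform_prob integral_uniform_pdf setIidl//.
rewrite (eq_integral (cst 1%E)) ?integral_cst ?mul1e// => x.
by rewrite inE => /A01 /=; rewrite in_itv/= /uniform_pdf => ->; rewrite subr0 invr1.
Qed.

(** The booleans treat open and closed endpoints together, and the maximum with 0 includes empty
    intervals, which occur in the countermonotone coupling. *)
Lemma uniform_prob_itv (x y : bool) (a b : R) : 0 <= a -> b <= 1 ->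
  U [set` Interval (BSide x a) (BSide y b)] = (Num.max 0 (b - a))%:E.
Proof.
move=> a0 b1; rewrite uniform_prob_sub.
- rewrite lebesgue_measure_itv/= lte_fin; case: ltP => ab.
    by rewrite -EFinD max_r// subr_ge0 ltW.
  by rewrite max_l// subr_le0.
- exact: measurable_itv.
- move=> u /=; rewrite !in_itv/= => /andP[au ub]; apply/andP; split.
    by apply: le_trans a0 _; move: au; case: x => //= /ltW.
  by apply: le_trans _ b1; move: ub; case: y => //= /ltW.
Qed.

End Uniform.

(** * Equality of joint laws and the conditional convex order *)

Section Equivalence.
Context d (T : measurableType d) d' (T' : measurableType d') (R : realType).
Context (P : probability T R) (P' : probability T' R).
Variables (Y X : {RV P >-> R}) (Y' X' : {RV P' >-> R}).
Hypotheses (YX : bivariate_bernoulli Y X) (YX' : bivariate_bernoulli Y' X').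

(** Given both marginals, the mass at (1, 1) fixes those at (1, 0) and (0, 1) by subtraction, and
    total mass fixes the last one. *)
Lemma bernoulli_law_eq : pmf Y 1 = pmf Y' 1 -> pmf X 1 = pmf X' 1 ->
  (forall A : set (R * R), measurable A ->
    pushforward P (fun w => (Y w, X w)) A =
    pushforward P' (fun w => (Y' w, X' w)) A) <->
  joint_pmf Y X 1 1 = joint_pmf Y' X' 1 1.
Proof.
move=> qq pp; split=> [eqA|j11 A mA].
  have := congr1 fine (eqA _ (measurableX (measurable_set1 1) (measurable_set1 1))).
  exact: id.
rewrite /pushforward.
rewrite (prob_fineE P (measurable_pair_RV X Y mA)).
rewrite (prob_fineE P' (measurable_pair_RV X' Y' mA)); congr _%:E.
rewrite (bernoulli_joint_law YX mA) (bernoulli_joint_law YX' mA).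
have := joint_pmf_sum YX; have := joint_pmf_sum YX'.
move: qq pp; rewrite (pmf_fst YX) (pmf_fst YX') (pmf_snd YX) (pmf_snd YX') j11.
move=> /addIr <- /addIr <- /= s' s.
by have -> : joint_pmf Y X 0 0 = joint_pmf Y' X' 0 0 by lra.
Qed.

Lemma ccx_le_bernoulli :
  let q := pmf Y 1 in let p := pmf X 1 in
  let alpha := joint_pmf Y X 0 0 / (1 - p) in
  let beta := joint_pmf Y X 0 1 / p in
  let q' := pmf Y' 1 in let p' := pmf X' 1 in
  let alpha' := joint_pmf Y' X' 0 0 / (1 - p') in
  let beta' := joint_pmf Y' X' 0 1 / p' in
  0 < q < 1 -> 0 < p < 1 -> 0 < q' < 1 -> 0 < p' < 1 ->
  ccx_le Y X Y' X' <->
    [/\ q = q', Num.min alpha' beta' <= Num.min alpha beta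
      & Num.max alpha beta <= Num.max alpha' beta'].
Proof.
move=> q p alpha beta q' p' alpha' beta' q01 p01 q01' p01'.
(* The conditional probabilities take the values [1 - alpha] and [1 - beta], so minima and maxima
   trade places. *)
have minE a b : Num.min (1 - a) (1 - b) = 1 - Num.max a b :> R.
  by rewrite /Num.min /Num.max; case: ltP => ?; case: ltP => ?; lra.
have maxE a b : Num.max (1 - a) (1 - b) = 1 - Num.min a b :> R.
  by rewrite /Num.min /Num.max; case: ltP => ?; case: ltP => ?; lra.
have ccxE : ccx_le Y X Y' X' <-> forall v, 0 < v < 1 ->
    forall phi : R -> R, convex_function [set: R] phi ->
    (if v <= 1 - q then phi 1
     else (1 - p) * phi (1 - alpha) + p * phi (1 - beta)) <=
    (if v <= 1 - q' then phi 1
     else (1 - p') * phi (1 - alpha') + p' * phi (1 - beta')).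
  split=> H v v01 phi cphi; have := H v v01 phi cphi;
    rewrite (expectation_cond_prob_bernoulli YX q01 p01 v01 (convex_measurable cphi));
    by rewrite (expectation_cond_prob_bernoulli YX' q01' p01' v01 (convex_measurable cphi)) lee_fin.
have mean : (1 - p) * (1 - alpha) + p * (1 - beta) = q := pmf_fstE YX p01.
have mean' : (1 - p') * (1 - alpha') + p' * (1 - beta') = q' := pmf_fstE YX' p01'.
rewrite ccxE; split=> [ccx|[qq min_le max_le] v _ phi cphi].
- have qq : q = q'.
    (* At the larger of [1 - q] and [1 - q'], one conditional probability is almost surely 1 while
       the other has mean below 1. The identity or its opposite, both convex, detects the
       difference. *)
    apply/eqP; case: (ltgtP q q') => // qq.
      have v01 : 0 < 1 - q < 1 by lra.
      have := ccx _ v01 _ (@convex_id R); rewrite lexx ifF; last lra.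
      by rewrite mean'; lra.
    have v01 : 0 < 1 - q' < 1 by lra.
    have := ccx _ v01 _ (@convex_opp R); rewrite lexx ifF; last lra.
    by move: mean; lra.
  (* This level exceeds [1 - q = 1 - q'], so both sides are in the two-point regime. *)
  have v01 : 0 < 1 - q / 2 < 1 by lra.
  have := convex_two_point_range p01 (r' := p') (a := 1 - alpha) (b := 1 - beta)
    (a' := 1 - alpha') (b' := 1 - beta').
  case=> [phi cphi|]; first by have := ccx _ v01 _ cphi; rewrite !ifF//; lra.
  by rewrite !minE !maxE; split=> //; lra.
- rewrite -qq; case: ifP => // _; apply: convex_two_point => //.
  + by case/andP: p01 => /ltW -> /ltW.
  + by rewrite mean mean'.
  + by rewrite !minE lerD2l lerN2.
  + by rewrite !maxE lerD2l lerN2.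
Qed.

End Equivalence.

(** * Independence, perfect dependence and extremal couplings *)

Section Dependence.
Context d (T : measurableType d) (R : realType) (P : probability T R).
Variables Y X : {RV P >-> R}.
Hypothesis YX : bivariate_bernoulli Y X.
Local Notation j := (joint_pmf Y X).
Local Notation q := (pmf Y 1).
Local Notation p := (pmf X 1).
Hypothesis q01 : 0 < q < 1.
Hypothesis p01 : 0 < p < 1.
Let alpha := j 0 0 / (1 - p).
Let beta := j 0 1 / p.

(** When the conditional probabilities of [Y = 0] agree, the four joint masses factor, and the
    probability of any rectangle is a combination of these masses. *)
Lemma independent_bernoulli : independent_rv X Y <-> alpha = beta.
Proof.
have p0 : p != 0 by rewrite gt_eqF//; case/andP: p01.
have p1 : 1 - p != 0 by rewrite subr_eq0 gt_eqF//; case/andP: p01.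
have jE y x : j y x = fine (P (X @^-1` [set x] `&` Y @^-1` [set y])).
  by rewrite setIC.
split=> [indep|ab A B mA mB].
  have indE x y : j y x = pmf X x * pmf Y y.
    rewrite jE indep// fineM// fin_num_measure//; exact: measurable_funPTI.
  rewrite /alpha /beta !indE (bernoulli_pmf0 (bernoulli_snd YX)).
  by rewrite ![_ * pmf Y 0]mulrC !mulfK.
have mXA : measurable (X @^-1` A) by exact: measurable_funPTI.
have mYB : measurable (Y @^-1` B) by exact: measurable_funPTI.
rewrite (prob_fineE P mXA) (prob_fineE P mYB) -EFinM.
rewrite (prob_fineE P (measurableI _ _ mXA mYB)); congr _%:E.
have := bernoulli_rectangle YX measurableT mA.
have := bernoulli_rectangle YX mB measurableT.
rewrite !preimage_setT setTI setIT !indicT/= => -> ->.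
rewrite setIC (bernoulli_rectangle YX mB mA) alphaE// betaE// joint_pmf10// joint_pmf11//.
by rewrite -/alpha -/beta ab; ring.
Qed.

(** If [Y = f(X)], then for each value of [X] some value of [Y] has mass zero, which forces [alpha]
    and [beta] into {0, 1}. *)
Lemma perfectly_depends_bernoulli : perfectly_depends Y X <->
  Num.min alpha beta = 0 /\ Num.max alpha beta = 1.
Proof.
have p0 : p != 0 by rewrite gt_eqF//; case/andP: p01.
have p1 : 1 - p != 0 by rewrite subr_eq0 gt_eqF//; case/andP: p01.
have mean : (1 - p) * (1 - alpha) + p * (1 - beta) = q := pmf_fstE YX p01.
split=> [[f mf Yf]|].
  have jf y x : f x != y -> j y x = 0.
    move=> /eqP fxy; apply: joint_pmf_eq0; apply: filterS Yf => w YfX [Yw Xw].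
    by apply: fxy; rewrite -Xw -YfX.
  have alpha01 : alpha = 0 \/ alpha = 1.
    have [f0|/jf j00] := eqVneq (f 0) 0; last by left; rewrite /alpha j00 mul0r.
    right; apply/eqP; rewrite eq_sym -subr_eq0.
    have := jf 1 0; rewrite f0 eq_sym oner_eq0 => /(_ isT)/eqP.
    by rewrite joint_pmf10// mulf_eq0 (negbTE p1) orbF.
  have beta01 : beta = 0 \/ beta = 1.
    have [f1|/jf j01] := eqVneq (f 1) 0; last by left; rewrite /beta j01 mul0r.
    right; apply/eqP; rewrite eq_sym -subr_eq0.
    have := jf 1 1; rewrite f1 eq_sym oner_eq0 => /(_ isT)/eqP.
    by rewrite joint_pmf11// mulf_eq0 (negbTE p0) orbF.
  (* Equal values of [alpha] and [beta] would give [q = 1] or [q = 0]. *)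
  move: mean; case: alpha01 => ->; case: beta01 => -> mean.
  - by move: mean q01; lra.
  - by rewrite min_l// max_r.
  - by rewrite min_r// max_l.
  - by move: mean q01; lra.
move=> [min0 max1].
have [[a0 b1]|[a1 b0]] : (alpha = 0 /\ beta = 1) \/ (alpha = 1 /\ beta = 0).
  by move: min0 max1; case: (leP alpha beta) => _ -> ->; [left|right].
(* With [alpha = 0] and [beta = 1] the diagonal masses vanish, leaving [Y = 1 - X]; in the other
   case the off-diagonal ones vanish, leaving [Y = X]. *)
- exists (fun x => 1 - x); first exact: measurable_funB.
  have /joint_pmf_ae0 n00 : j 0 0 = 0 by rewrite alphaE// -/alpha a0 mul0r.
  have /joint_pmf_ae0 n11 : j 1 1 = 0 by rewrite joint_pmf11// -/beta b1 subrr mul0r.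
  apply: filterS3 YX n00 n11 => w [[Yw|Yw] [Xw|Xw]] /= N00 N11;
    rewrite Yw Xw ?subr0 ?subrr//; by [case: N00|case: N11].
- exists id => //.
  have /joint_pmf_ae0 n10 : j 1 0 = 0 by rewrite joint_pmf10// -/alpha a1 subrr mul0r.
  have /joint_pmf_ae0 n01 : j 0 1 = 0 by rewrite betaE// -/beta b0 mul0r.
  apply: filterS3 YX n10 n01 => w [[Yw|Yw] [Xw|Xw]] /= N10 N01;
    rewrite Yw Xw//; by [case: N10|case: N01].
Qed.

Local Notation U := (uniform_prob (@ltr01 R)).

(** The two indicators form a bivariate Bernoulli vector on the uniform space, with the same
    marginals as [Y] and [X], so only the mass at (1, 1) remains to be compared. *)
Lemma uniform_bernoulli_law (I J : set (measurableTypeR R)) (mI : measurable I)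
    (mJ : measurable J)
    (c : R) :
  U I = q%:E -> U J = p%:E -> U (I `&` J) = c%:E ->
  (forall A : set (R * R), measurable A ->
    pushforward P (fun w => (Y w, X w)) A =
    pushforward U (fun u : R => (\1_I u : R, \1_J u : R)) A) <-> j 1 1 = c.
Proof.
have pre (S : set (measurableTypeR R)) (mS : measurable S) :
    [set u | mindic R mS u = 1 :> R] = S.
  apply/seteqP; split=> u /=; rewrite mindicE; last by move=> /mem_set ->.
  by case: (boolP (u \in S)) => [/set_mem//|_ /eqP]; rewrite eq_sym oner_eq0.
move=> UI UJ UIJ.
pose V : {RV U >-> R} := mindic R mI.
pose W : {RV U >-> R} := mindic R mJ.
have VW : bivariate_bernoulli V W.
  have ind01 (S : set (measurableTypeR R)) (mS : measurable S) u :
      mindic R mS u = 0 :> R \/ mindic R mS u = 1 :> R.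
    by rewrite mindicE; case: (u \in S); [right|left].
  by apply: aeW => u; split; exact: ind01.
have V1 : pmf V 1 = q by rewrite -[RHS]/(fine q%:E) -UI; congr fine;
  rewrite -[in RHS](pre _ mI).
have W1 : pmf W 1 = p by rewrite -[RHS]/(fine p%:E) -UJ; congr fine;
  rewrite -[in RHS](pre _ mJ).
have VW11 : joint_pmf V W 1 1 = c.
  by rewrite -[RHS]/(fine c%:E) -UIJ; congr fine;
    rewrite -[in RHS](pre _ mI) -[in RHS](pre _ mJ).
by rewrite -VW11; apply: (bernoulli_law_eq YX VW).
Qed.

(** Converts conditions on the mass at (1, 1) into conditions on [alpha]. *)
Let joint_pmf00 : j 0 0 = 1 - p - q + j 1 1.
Proof. by have := joint_pmf_sum YX; rewrite (pmf_fst YX) (pmf_snd YX); lra. Qed.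


(** Both quantile functions are indicators of intervals ending at 1. These are nested, so they meet
    in the shorter one, whose length is the upper Fréchet bound. *)
Lemma comonotone_bernoulli :
  comonotone X Y <-> alpha = Num.min ((1 - q) / (1 - p)) 1.
Proof.
have [q0 q1] := andP q01; have [p0 p1] := andP p01.
have p1' : 0 < 1 - p by rewrite subr_gt0.
have -> : comonotone X Y <-> j 1 1 = Num.min q p.
  rewrite /comonotone.
  have -> : (fun u : R => (quantile Y u, quantile X u)) =
      fun u => (\1_`]1 - q, 1] u, \1_`]1 - p, 1] u).
    apply/funext => u; rewrite !bernoulli_quantile//.
      exact: bernoulli_snd YX.
    exact: bernoulli_fst YX.
  apply: uniform_bernoulli_law; try exact: measurable_itv.
  - rewrite uniform_prob_itv ?subKr ?max_r//; lra.
  - rewrite uniform_prob_itv ?subKr ?max_r//; lra.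
  - have [qp|pq] := leP q p.
      rewrite setIidl; last by apply: subset_itvr; rewrite bnd_simp lerD2l lerN2.
      rewrite uniform_prob_itv ?subKr ?max_r//; lra.
    rewrite setIidr; last by apply: subset_itvr; rewrite bnd_simp lerD2l lerN2 ltW.
    rewrite uniform_prob_itv ?subKr ?max_r//; lra.
have -> : alpha = Num.min ((1 - q) / (1 - p)) 1 <->
    j 0 0 = Num.min (1 - q) (1 - p).
  rewrite alphaE// -/alpha; have -> : Num.min (1 - q) (1 - p) =
    Num.min ((1 - q) / (1 - p)) 1 * (1 - p).
    by rewrite minr_pMl ?ltW// mul1r divfK// gt_eqF.
  by split=> [->//|/mulIf -> //]; rewrite gt_eqF.
rewrite joint_pmf00; have [qp|pq] := leP q p.
  by rewrite min_r; [split; lra|lra].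
by rewrite min_l; [split; lra|lra].
Qed.

(** The reflection moves the interval of [X] to the left end of the unit interval, where its overlap
    with that of [Y] is smallest: the lower Fréchet bound. *)
Lemma countermonotone_bernoulli :
  countermonotone X Y <-> alpha = Num.max 0 (1 - q / (1 - p)).
Proof.
have [q0 q1] := andP q01; have [p0 p1] := andP p01.
have p1' : 0 < 1 - p by rewrite subr_gt0.
have -> : countermonotone X Y <-> j 1 1 = Num.max 0 (p + q - 1).
  rewrite /countermonotone.
  (* Under [u |-> 1 - u] the interval []1 - p, 1]] becomes [[0, p[], with its closed end now on the
     left. *)
  have -> : (fun u : R => (quantile Y u, quantile X (1 - u))) =
      fun u => (\1_`]1 - q, 1] u, \1_`[0, p[ u).
    apply/funext => u; rewrite !bernoulli_quantile//; last first.
    - exact: bernoulli_fst YX.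
    - exact: bernoulli_snd YX.
    congr pair; rewrite !indicE; congr (nat_of_bool _)%:R.
    by apply/idP/idP; rewrite !inE/= !in_itv/= => /andP[? ?]; apply/andP; split; lra.
  apply: uniform_bernoulli_law; try exact: measurable_itv.
  - rewrite uniform_prob_itv ?subKr ?max_r//; lra.
  - rewrite uniform_prob_itv ?subr0 ?max_r//; lra.
  (* The overlap is empty when [p + q <= 1], which accounts for the maximum with 0. *)
  - have -> : `]1 - q, 1] `&` `[0, p[ = `]1 - q, p[%classic.
      apply/seteqP; split=> u /=; rewrite !in_itv/=.
        by move=> [/andP[-> _] /andP[_ ->]].
      by move=> /andP[? ?]; split; apply/andP; split; lra.
    rewrite uniform_prob_itv; [|lra..]; congr (Num.max 0 _)%:E; ring.
have -> : alpha = Num.max 0 (1 - q / (1 - p)) <->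
    j 0 0 = Num.max 0 (1 - p - q).
  rewrite alphaE// -/alpha; have -> : Num.max 0 (1 - p - q) =
    Num.max 0 (1 - q / (1 - p)) * (1 - p).
    by rewrite maxr_pMl ?ltW// mul0r mulrBl mul1r divfK// gt_eqF.
  by split=> [->//|/mulIf -> //]; rewrite gt_eqF.
rewrite joint_pmf00; have [qp|pq] := leP 0 (p + q - 1).
  by rewrite max_l; [split; lra|lra].
by rewrite max_r; [split; lra|lra].
Qed.

End Dependence.

Theorem proposition2p5 (R : realType) (d d' : measure_display)
    (T : measurableType d) (T' : measurableType d')
    (P : probability T R) (P' : probability T' R)
    (Y X : {RV P >-> R}) (Y' X' : {RV P' >-> R}) :
  bivariate_bernoulli Y X -> bivariate_bernoulli Y' X' ->
  let q := pmf Y 1 in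
  let p := pmf X 1 in
  let alpha := joint_pmf Y X 0 0 / (1 - p) in
  let beta := joint_pmf Y X 0 1 / p in
  let q' := pmf Y' 1 in
  let p' := pmf X' 1 in
  let alpha' := joint_pmf Y' X' 0 0 / (1 - p') in
  let beta' := joint_pmf Y' X' 0 1 / p' in
  0 < q < 1 -> 0 < p < 1 -> 0 < q' < 1 -> 0 < p' < 1 ->
  (ccx_le Y X Y' X' <->
    [/\ q = q', Num.min alpha' beta' <= Num.min alpha beta
      & Num.max alpha beta <= Num.max alpha' beta']) /\
  (independent_rv X Y <-> alpha = beta) /\
  (perfectly_depends Y X <-> Num.min alpha beta = 0 /\ Num.max alpha beta = 1) /\
  (comonotone X Y <-> alpha = Num.min ((1 - q) / (1 - p)) 1) /\
  (countermonotone X Y <-> alpha = Num.max 0 (1 - q / (1 - p))).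
Proof.
move=> YX YX' q p alpha beta q' p' alpha' beta' q01 p01 q01' p01'.
split; first exact: ccx_le_bernoulli.
split; first exact: independent_bernoulli.
split; first exact: perfectly_depends_bernoulli.
split; first exact: comonotone_bernoulli.
exact: countermonotone_bernoulli.
Qed.
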